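(* Let $A,B\in\mathrm{SL}_2\mathbb{Z}_{\ge0}$ be noncommuting and such that the pair $A,B$ is well oriented, and assume $\mathrm{tr}(A)<\mathrm{tr}(B)$ and $\mathrm{tr}(AB)=\mathrm{tr}(B^2)$. Then $ab^2$ is the only optimal word.
   Context: $\mathrm{SL}_2\mathbb{Z}_{\ge0}$ denotes the $2\times2$ matrices with nonnegative integer entries and determinant $1$. Fixed points are taken for the Möbius action on $\partial\mathcal{H}=\mathbb{P}^1\mathbb{R}$; $\alpha^\pm$ ($\beta^\pm$) are the attracting/repelling fixed points of $A$ ($B$), equal to the unique fixed point if parabolic. With $\partial\mathcal{H}$ cyclically ordered and $[\alpha,\beta]$ the closed counterclockwise interval from $\alpha$ to $\beta$, let $I^+=\{\alpha^+\}$ if $\alpha^+=\beta^+$, and otherwise the one of $[\alpha^+,\beta^+],[\beta^+,\alpha^+]$ mapped into itself by both $A$ and $B$ (if it exists); define $I^-$ likewise with $A^{-1},B^{-1},\alpha^-,\beta^-$. The pair is coherently oriented if both exist, and well oriented if $A,B$ is coherently oriented but $A,B^{-1}$ is not. Words: $F_2^+$ is the free semigroup of nonempty words over $\{a,b\}$, $|w|$ the length, $\phi(a)=A,\phi(b)=B$, $[w]=\mathrm{tr}(\phi(w))$. Define $w\preceq u$ iff $[w^{|u|}]\le[u^{|w|}]$; $w$ is maximal if $u\preceq w$ for all $u$. A Lyndon word is one strictly smaller lexicographically ($a<b$) than each of its proper rotations. A complete set of optimal words is a set of pairwise distinct maximal Lyndon words such that every maximal word is a power of a rotation of one of them; it is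 unique if it exists, and its elements are the optimal words. *)

(* Defs.v *)
From Stdlib Require Import Rdefinitions.
From HB Require Import structures.
From mathcomp Require Import all_boot all_order all_algebra.
From mathcomp Require Import Rstruct.
Set Implicit Arguments. Unset Strict Implicit. Unset Printing Implicit Defensive.
Import Order.TTheory GRing.Theory Num.Theory.
Local Open Scope ring_scope.

Definition i0 : 'I_2 := ord0.
Definition i1 : 'I_2 := ord_max.

Definition SL2Znn (M : 'M[int]_2) : Prop :=
  (forall i j, 0 <= M i j) /\ \det M = 1.

(* None stands for the point at infinity; Some z for z ∈ R.
   The matrix [[p,q],[r,s]] acts by z |-> (p z + q)/(r z + s),
   i.e. by its linear action on the line spanned by (z,1) (resp. (1,0)). *)
Definition P1 := option R.

Definition realmx (M : 'M[int]_2) : 'M[R]_2 := map_mx (fun z : int => z%:~R) M.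

Definition mobius (M : 'M[R]_2) (x : P1) : P1 :=
  let p := M i0 i0 in let q := M i0 i1 in
  let r := M i1 i0 in let s := M i1 i1 in
  match x with
  | Some z => if r * z + s != 0 then Some ((p * z + q) / (r * z + s)) else None
  | None => if r != 0 then Some (p / r) else None
  end.

Definition fixpt (M : 'M[R]_2) (x : P1) : Prop := mobius M x = x.

(* eigenvalue of M on the line represented by a fixed point x *)
Definition eigval (M : 'M[R]_2) (x : P1) : R :=
  match x with
  | Some z => M i1 i0 * z + M i1 i1
  | None => M i0 i0
  end.

(* attracting fixed point (the unique fixed point if M is parabolic) *)
Definition attracting (M : 'M[R]_2) (x : P1) : Prop :=
  fixpt M x /\ (\tr M = 2 \/ 1 < eigval M x).

(* Counterclockwise = increasing along R, passing through oo from +oo to -oo.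
   Position key: reals in their order, oo after all reals. *)
Definition p1le (x y : P1) : Prop :=
  match x, y with
  | Some a, Some b => a <= b
  | _, None => True
  | None, Some _ => False
  end.

Definition ccw_arc (a b : P1) (x : P1) : Prop :=
  (p1le a b /\ p1le a x /\ p1le x b) \/ (~ p1le a b /\ (p1le a x \/ p1le x b)).

Definition arc_invariant (M : 'M[R]_2) (a b : P1) : Prop :=
  forall x, ccw_arc a b x -> ccw_arc a b (mobius M x).

(* "I exists" for the pair (M,N): with m, n the attracting fixed points of
   M, N, either m = n (then I = {m}) or one of [m,n], [n,m] is mapped into
   itself by both M and N. *)
Definition I_exists (M N : 'M[R]_2) : Prop :=
  exists m n, attracting M m /\ attracting N n /\
    (m = n \/
     (arc_invariant M m n /\ arc_invariant N m n) \/
     (arc_invariant M n m /\ arc_invariant N n m)).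

(* I^+ uses A, B; I^- uses A^-1, B^-1 (whose attracting points are the
   repelling points of A, B). *)
Definition coherently_oriented (M N : 'M[R]_2) : Prop :=
  I_exists M N /\ I_exists (invmx M) (invmx N).

Definition well_oriented (A B : 'M[int]_2) : Prop :=
  coherently_oriented (realmx A) (realmx B) /\
  ~ coherently_oriented (realmx A) (invmx (realmx B)).

(* letters: false = a, true = b; F_2^+ = nonempty seq bool *)
Definition word := seq bool.

Definition phi (A B : 'M[int]_2) (w : word) : 'M[int]_2 :=
  \prod_(c <- w) (if c then B else A).

Definition wtr (A B : 'M[int]_2) (w : word) : int := \tr (phi A B w).

Definition wpow (w : word) (n : nat) : word := flatten (nseq n w).

Definition wle (A B : 'M[int]_2) (w u : word) : Prop :=
  wtr A B (wpow w (size u)) <= wtr A B (wpow u (size w)).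

Definition maximal (A B : 'M[int]_2) (w : word) : Prop :=
  w != [::] /\ forall u : word, u != [::] -> wle A B u w.

Fixpoint lexlt (u v : word) : bool :=
  match u, v with
  | [::], [::] => false
  | [::], _ :: _ => true
  | _ :: _, [::] => false
  | x :: u', y :: v' => (~~ x && y) || ((x == y) && lexlt u' v')
  end.

Definition lyndon (w : word) : Prop :=
  w != [::] /\ forall k, (0 < k < size w)%N -> lexlt w (rot k w).

(* S (a set of words, given as a predicate) is a complete set of optimal
   words; distinctness of its elements is automatic for a set. *)
Definition complete_optimal (A B : 'M[int]_2) (S : word -> Prop) : Prop :=
  (forall s, S s -> maximal A B s /\ lyndon s) /\
  (forall w, maximal A B w ->
     exists s k n, S s /\ w = wpow (rot k s) n).

Definition w_abb : word := [:: false; true; true].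

(* Main.v *)
Require Import Defs.
From HB Require Import structures.
From mathcomp Require Import all_boot all_order all_algebra.
From mathcomp Require Import ring lra zify.
From mathcomp Require Import Rstruct.
Set Implicit Arguments. Unset Strict Implicit. Unset Printing Implicit Defensive.
Import Order.TTheory GRing.Theory Num.Theory.
Local Open Scope ring_scope.

(* Let a = tr A, b = tr B.  By Cayley-Hamilton tr(AB^2) = b^3 - 2b - a, which is
   k + 1/k for some k = m^3 > 1; let v > 0 be a Perron vector, AB^2 v = k v, and put
   v_i = m^-i B^i v for i = 0, 1, 2.  Then B v_0 = m v_1, B v_1 = m v_2 and
   A v_2 = m v_0, while the remaining three steps lose in both coordinates:
   A v_0 < m v_0, A v_1 < m v_0, B v_2 < m v_2.  Running this three-state automaton
   along a word w that begins with a gives phi(w) v < m^|w| v unless w is a power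
   of abb (words b^n are run from v_2 instead).  For a nonnegative matrix M of
   determinant 1, M v < s v with v > 0 forces tr M < s + 1/s, and s + 1/s is the
   trace of (AB^2)^n when s = k^n; so, up to rotation, only powers of abb are
   maximal. *)

(** * Numerical estimates for the cube root of the Perron eigenvalue *)

(** The equation says b^3 - m^3 = 2b + a + m^-3, which makes b - m at most about 1/b. The three
    conclusions are the scalar inequalities behind the three lossy transitions in
    [suboptimal_steps]. *)
Lemma cube_root_bounds (F : realFieldType) (a b m : F) :
    2 <= a -> a + 1 <= b -> (a = 2 /\ b = 3) \/ 4 <= b -> 1 < m ->
    m ^+ 3 + (m ^+ 3)^-1 = b ^+ 3 - 2 * b - a ->
  [/\ a < m, a < m ^+ 2 * (b - m) &
      ((b - m) * b - 1) * (a * m ^+ 3 + 1) < (b - m) * b].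
Proof.
move=> a2 ab bcase m1 trm.
set k := m ^+ 3 in trm *.
have k0 : 0 < k by rewrite exprn_gt0 //; lra.
set j := k^-1 in trm.
have j0 : 0 < j by rewrite invr_gt0.
have kj : k * j = 1 by rewrite divff // gt_eqF.
have b3 : 3 <= b by lra.
have k1 : 1 < k by rewrite exprn_egt1.
have j1 : j < 1 by rewrite invf_lt1.
have bb : 9 <= b ^+ 2 by nra.
(* Since a <= b - 1 and j < 1, k exceeds b^3 - 3b, which is at least 18 for b >= 3. *)
have k18 : 18 < k.
  have : 18 <= b * (b ^+ 2 - 3) by nra.
  have -> : b * (b ^+ 2 - 3) = b ^+ 3 - 3 * b by ring.
  lra.
have j18 : 18 * j < 1 by nra.
have kE : k = m * (m * m) by rewrite /k; ring.
have mb : m < b.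
  rewrite -(@ltr_pXn2r _ 3) ?nnegrE; [|by []|lra|lra].
  by rewrite -/k; lra.
pose th := b - m.
have -> : b - m = th by [].
have mE : m = b - th by rewrite /th; ring.
have th0 : 0 < th by rewrite /th; lra.
(* If m < b - 1/b, cubing gives 1 - j < 3/b - 1/b^3, absurd for b >= 4 because j < 1/18. This fails
   at b = 3, where k = 19 - j is instead compared with (133/50)^3 < 18.9, and 133/50 = 3 - 17/50. *)
have thb : th * b <= 1 \/ [/\ a = 2, b = 3 & 50 * th < 17].
  case: bcase => [[aE bE]|b4]; [right|left].
    split=> //; rewrite ltNge; apply/negP=> h.
    have m3 : 50 * m <= 133 by lra.
    have : (50 * m) ^+ 3 <= 133 ^+ 3.
      by rewrite lerXn2r // nnegrE; lra.
    rewrite aE bE in trm; rewrite exprMn -/k; lra.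
  rewrite leNgt; apply/negP=> h.
  have b0 : 0 < b by lra.
  pose i := b^-1.
  have i0 : 0 < i by rewrite invr_gt0.
  have bi : b * i = 1 by rewrite divff // gt_eqF.
  have i4 : 4 * i <= 1 by nra.
  have mi : m < b - i by nra.
  have : m ^+ 3 < (b - i) ^+ 3 by rewrite ltr_pXn2r ?nnegrE //; lra.
  have -> : (b - i) ^+ 3 = b ^+ 3 - 3 * b * (b * i) + 3 * i * (b * i) - i ^+ 3 by ring.
  rewrite bi -/k.
  have : 0 < i ^+ 3 by rewrite exprn_gt0.
  lra.
have th1 : 20 * th < 7 by case: thb => [h|[_ _ h]]; [nra|lra].
have thb2 : 50 * (th * b) <= 51 by case: thb => [h|[_ -> h]]; lra.
split; first lra.
(* Write b^3 - m^3 as 3 m^2 th + 3 b th^2 - 2 th^3. If m^2 th <= a, then 2(b - a) + j is at most 3 b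
   th^2, hence below 2, against b - a >= 1. *)
- rewrite ltNge; apply/negP=> h.
  have e1 : 3 * b ^+ 2 * th - 3 * b * th ^+ 2 + th ^+ 3 = 2 * b + a + j.
    have : k = (b - th) ^+ 3 by rewrite -mE.
    have -> : (b - th) ^+ 3 = b ^+ 3 - (3 * b ^+ 2 * th - 3 * b * th ^+ 2 + th ^+ 3).
      by ring.
    lra.
  have e2 : b ^+ 2 * th - 2 * b * th ^+ 2 + th ^+ 3 <= a.
    by apply: le_trans h; rewrite mE le_eqVlt; apply/orP; left; apply/eqP; ring.
  have e3 : th ^+ 2 * b <= 51 / 50 * th.
    rewrite expr2 -mulrA mulrC ler_wpM2r //; lra.
  have e4 : 0 < th ^+ 3 by rewrite exprn_gt0.
  have e5 : 3 * b ^+ 2 * th - 3 * b * th ^+ 2 + th ^+ 3 =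
    3 * (b ^+ 2 * th - 2 * b * th ^+ 2 + th ^+ 3) + 3 * (th ^+ 2 * b) - 2 * th ^+ 3.
    by ring.
  lra.
(* Either the first factor is nonpositive, or a = 2 and b = 3, and the factors are below 1/50 and
   39. *)
- case: thb => [h|[aE bE h]].
    have u : 0 < th * b by nra.
    have w : 0 < a * k + 1 by nra.
    nra.
  have k19 : k < 19 by rewrite aE bE in trm; lra.
  rewrite aE bE; nra.
Qed.

(** * Two-by-two matrices in coordinates *)

Lemma ord2P (P : 'I_2 -> Prop) : P ord0 -> P ord_max -> forall i, P i.
Proof.
move=> P0 P1 [[|[|//]] lti].
- by rewrite (_ : Ordinal lti = ord0) //; apply: val_inj.
- by rewrite (_ : Ordinal lti = ord_max) //; apply: val_inj.
Qed.

Lemma sum2 (V : nmodType) (f : 'I_2 -> V) : \sum_i f i = f ord0 + f ord_max.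
Proof. by rewrite big_ord_recr big_ord1; congr (f _ + _); apply: val_inj. Qed.

Lemma det2 (R : comPzRingType) (M : 'M[R]_2) :
  \det M = M ord0 ord0 * M ord_max ord_max - M ord0 ord_max * M ord_max ord0.
Proof.
have l0 : lift ord0 ord0 = ord_max :> 'I_2 by apply: val_inj.
have l1 : lift ord_max ord0 = ord0 :> 'I_2 by apply: val_inj.
rewrite (expand_det_row _ ord0) sum2 /cofactor !det_mx11 !mxE l0 l1 /=.
by rewrite expr0 expr1 mul1r mulN1r mulrN.
Qed.

Lemma mxtrace2 (R : pzSemiRingType) (M : 'M[R]_2) :
  \tr M = M ord0 ord0 + M ord_max ord_max.
Proof. exact: sum2. Qed.

Lemma mulmx2 (R : pzSemiRingType) n (M : 'M[R]_2) (N : 'M[R]_(2, n)) i j :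
  (M *m N) i j = M i ord0 * N ord0 j + M i ord_max * N ord_max j.
Proof. by rewrite mxE sum2. Qed.

Lemma Cayley_Hamilton2 (R : comPzRingType) (M : 'M[R]_2) :
  \det M = 1 -> M *m M = \tr M *: M - 1%:M.
Proof.
rewrite det2 mxtrace2 => dM; apply/matrixP.
by apply: ord2P; apply: ord2P; rewrite mulmx2 !mxE /= -?dM; ring.
Qed.

(** * Nonnegative matrices of determinant 1, strict vector inequalities and Perron vectors *)

(** Over [int] this unfolds to the same proposition as [SL2Znn]; the general ring lets it apply to
    the real images of A and B as well. *)
Definition nonneg_SL2 (R : numDomainType) (M : 'M[R]_2) : Prop :=
  (forall i j, 0 <= M i j) /\ \det M = 1.

Lemma nonneg_SL2_1 (R : numDomainType) : nonneg_SL2 (1%:M : 'M[R]_2).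
Proof. by split=> [i j|]; rewrite ?det1 // mxE; case: eqP. Qed.

Lemma nonneg_SL2_mul (R : numDomainType) (M N : 'M[R]_2) :
  nonneg_SL2 M -> nonneg_SL2 N -> nonneg_SL2 (M *m N).
Proof.
move=> [M0 dM] [N0 dN]; split; last by rewrite det_mulmx dM dN mulr1.
by move=> i j; rewrite mulmx2 addr_ge0 ?mulr_ge0.
Qed.

Definition vlt (R : numDomainType) n (u v : 'cV[R]_n) : Prop :=
  forall i, u i 0 < v i 0.

Lemma vlt_trans (R : numDomainType) n (v u w : 'cV[R]_n) :
  vlt u v -> vlt v w -> vlt u w.
Proof. by move=> uv vw i; apply: lt_trans (uv i) (vw i). Qed.

Lemma vltZ (R : numDomainType) n (s : R) (u v : 'cV[R]_n) :
  0 < s -> vlt u v -> vlt (s *: u) (s *: v).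
Proof. by move=> s0 uv i; rewrite !mxE ltr_pM2l. Qed.

(** A zero row would make the determinant vanish, so every row has a positive entry, and that entry
    carries the strict inequality. *)
Lemma vlt_mulmx (R : realFieldType) (M : 'M[R]_2) (u v : 'cV[R]_2) :
  nonneg_SL2 M -> vlt u v -> vlt (M *m u) (M *m v).
Proof.
move=> [M0 dM] uv i; rewrite !mulmx2.
have [Mi0|Mi0] := eqVneq (M i ord0) 0; last first.
  apply: ltr_leD; first by rewrite ltr_pM2l ?uv // lt_def Mi0 M0.
  by apply: ler_wpM2l => //; apply: ltW.
rewrite Mi0 !mul0r !add0r ltr_pM2l ?uv // lt_def M0 andbT.
apply: contra_eq_neq dM => Mi1; rewrite det2.
move: i Mi0 Mi1; apply: ord2P => -> ->;
by rewrite !(mul0r, mulr0) subrr eq_sym oner_eq0.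
Qed.

Lemma vlt_exp (R : realFieldType) (M : 'M[R]_2) (v : 'cV[R]_2) (s : R) k :
    nonneg_SL2 M -> 0 < s -> vlt (M *m v) (s *: v) ->
  vlt ((M ^+ k.+1) *m v) (s ^+ k.+1 *: v).
Proof.
move=> MP s0 Mv; elim: k => [|k IH]; first by rewrite !expr1.
rewrite exprS [_ * _ in X in vlt X _]/(_ *m _) -mulmxA.
apply: vlt_trans (vlt_mulmx MP IH) _.
by rewrite -scalemxAr [s ^+ k.+2]exprSr -scalerA; apply: vltZ; rewrite ?exprn_gt0.
Qed.

(** With M = [[p,q],[r,u]] and v = (x,y), the hypothesis reads q y < (s - p) x and r x < (s - u) y.
    Multiplying the two gives q r < (s - p)(s - u): the characteristic polynomial s^2 - s tr M + 1
    is positive at s. *)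
Lemma mxtrace_lt_of_vlt (R : realFieldType) (M : 'M[R]_2) (v : 'cV[R]_2) (s : R) :
    nonneg_SL2 M -> vlt 0 v -> 0 < s -> vlt (M *m v) (s *: v) ->
  \tr M < s + s^-1.
Proof.
move=> [M0 dM] v0 s0 Mv; rewrite mxtrace2; move: dM; rewrite det2.
move: (Mv ord0) (Mv ord_max) (v0 ord0) (v0 ord_max).
rewrite !mulmx2 !mxE; have := M0 ord0 ord_max; have := M0 ord_max ord0.
move: (M ord0 ord0) (M ord0 ord_max) (M ord_max ord0) (M ord_max ord_max).
move: (v ord0 0) (v ord_max 0) => x y p q r u r0 q0 px py x0 y0 dM.
have h1 : 0 <= q * y < (s - p) * x.
  by rewrite mulr_ge0 ?(ltW y0) //=; lra.
have h2 : 0 <= r * x < (s - u) * y.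
  by rewrite mulr_ge0 ?(ltW x0) //=; lra.
move: h1 h2 => /andP[h10 h1] /andP[h20 h2].
have h : (q * y) * (r * x) < ((s - p) * x) * ((s - u) * y).
  by apply: ltr_pM.
have xy : 0 < x * y by apply: mulr_gt0.
have h3 : 0 < (x * y) * (s * s + 1 - s * (p + u)) by nra.
rewrite pmulr_rgt0 // in h3.
rewrite -(ltr_pM2l s0) [ltRHS]mulrDr divff ?gt_eqF //; lra.
Qed.

Lemma mxtrace_eigen (R : fieldType) (M : 'M[R]_2) (v : 'cV[R]_2) (s : R) :
    \det M = 1 -> v != 0 -> s != 0 -> M *m v = s *: v ->
  \tr M = s + s^-1.
Proof.
move=> dM v0 s0 Mv.
have e : (s * \tr M - (s ^+ 2 + 1)) *: v = 0.
  have := congr1 (mulmx M) Mv; rewrite mulmxA Cayley_Hamilton2 // -scalemxAr Mv.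
  rewrite mulmxBl -scalemxAl mul1mx Mv !scalerA => e.
  by rewrite scalerBl scalerDl scale1r mulrC opprD addrA addrAC e subrr.
move/eqP: e; rewrite scaler_eq0 (negPf v0) orbF subr_eq0 => /eqP e.
by apply: (mulfI s0); rewrite e mulrDr divff.
Qed.

(** The vector is (M01, k - M00), which the first row of M - k kills. The numbers k - M00 and k -
    M11 have product M01 M10 > 0 and sum k - 1/k > 0, so both are positive. *)
Lemma perron_vector (R : realFieldType) (M : 'M[R]_2) (k : R) :
    nonneg_SL2 M -> 0 < M ord0 ord_max -> 0 < M ord_max ord0 -> 
    1 < k -> \tr M = k + k^-1 ->
  exists2 v : 'cV[R]_2, vlt 0 v & M *m v = k *: v.
Proof.
move=> [M0 dM] q0 r0 k1 trM.
have k0 : 0 < k by lra.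
have kk : k * k^-1 = 1 by rewrite divff // gt_eqF.
have j1 : k^-1 < 1 by rewrite invf_lt1.
move: trM dM; rewrite mxtrace2 det2 => trM dM.
have e : (k - M ord0 ord0) * (k - M ord_max ord_max) = M ord0 ord_max * M ord_max ord0.
  have -> : (k - M ord0 ord0) * (k - M ord_max ord_max) =
    k * k - k * (M ord0 ord0 + M ord_max ord_max) + M ord0 ord0 * M ord_max ord_max by ring.
  by rewrite trM mulrDr kk; lra.
have p0 : 0 < k - M ord0 ord0.
  rewrite ltNge; apply/negP => h.
  have : 0 < (k - M ord0 ord0) * (k - M ord_max ord_max) by rewrite e mulr_gt0.
  have : k - M ord_max ord_max > 0 by lra.
  by move=> h1; rewrite pmulr_lgt0 // ltNge h.
exists (\col_i if i == ord0 then M ord0 ord_max else k - M ord0 ord0).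
  by apply: ord2P; rewrite !mxE.
apply/matrixP=> i j; rewrite mulmx2 !mxE /= {j}; move: i.
apply: ord2P => /=; first by ring.
by rewrite [RHS](_ : _ = (k - M ord0 ord0) * (k - M ord_max ord_max) +
  M ord_max ord_max * (k - M ord0 ord0)); [rewrite e|]; ring.
Qed.

(** Integrality makes both diagonal entries at least 1, so their product is at least their sum minus
    1, hence above 1, and the off-diagonal product is positive. This supplies the positivity that
    [perron_vector] needs. *)
Lemma nonneg_SL2_offdiag (M : 'M[int]_2) :
  nonneg_SL2 M -> 2 < \tr M -> 0 < M ord0 ord_max /\ 0 < M ord_max ord0.
Proof.
move=> [M0]; rewrite det2 mxtrace2.
move: (M0 ord0 ord0) (M0 ord0 ord_max) (M0 ord_max ord0) (M0 ord_max ord_max).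
move: (M ord0 ord0) (M ord0 ord_max) (M ord_max ord0) (M ord_max ord_max).
move=> p q r u p0 q0 r0 u0 d t.
have qr : 0 <= q * r by rewrite mulr_ge0.
have p1 : 1 <= p by nia.
have u1 : 1 <= u by nia.
have pu : 0 <= (p - 1) * (u - 1) by rewrite mulr_ge0 ?subr_ge0.
have qr1 : 0 < q * r by lia.
by split; rewrite lt_def ?q0 ?r0 andbT; apply/eqP => h; rewrite h ?mul0r ?mulr0 in qr1.
Qed.

(** * Matrix products along words, powers and rotations of words *)

(** This is [phi] over an arbitrary ring, so that word products can be mapped to the reals; over
    [int] the two are convertible. *)
Definition wprod (R : pzRingType) (A B : 'M[R]_2) (w : word) : 'M[R]_2 :=
  \prod_(c <- w) (if c then B else A).

Lemma wprod_cons (R : pzRingType) (A B : 'M[R]_2) c w :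
  wprod A B (c :: w) = (if c then B else A) *m wprod A B w.
Proof. exact: big_cons. Qed.

Lemma wprod_cat (R : pzRingType) (A B : 'M[R]_2) u w :
  wprod A B (u ++ w) = wprod A B u *m wprod A B w.
Proof. exact: big_cat. Qed.

Lemma wprod_wpow (R : pzRingType) (A B : 'M[R]_2) w k :
  wprod A B (wpow w k) = wprod A B w ^+ k.
Proof.
elim: k => [|k IH]; first by rewrite expr0; apply: big_nil.
by rewrite /wpow /= wprod_cat IH exprS.
Qed.

Lemma wprod_nonneg_SL2 (R : numDomainType) (A B : 'M[R]_2) w :
  nonneg_SL2 A -> nonneg_SL2 B -> nonneg_SL2 (wprod A B w).
Proof.
move=> AP BP; elim: w => [|c w IH].
  by rewrite /wprod big_nil; apply: nonneg_SL2_1.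
by rewrite wprod_cons; apply: nonneg_SL2_mul => //; case: c.
Qed.

Lemma size_wpow w n : size (wpow w n) = (n * size w)%N.
Proof. by rewrite size_flatten /shape map_nseq sumn_nseq mulnC. Qed.

Lemma cat_wpow (u w : word) n : wpow (u ++ w) n ++ u = u ++ wpow (w ++ u) n.
Proof. by rewrite /wpow; elim: n => [|n IH] /=; rewrite ?cats0 // -!catA IH. Qed.

Lemma rot_wpow_le (w : word) n j :
  (j <= size w)%N -> rot j (wpow w n) = wpow (rot j w) n.
Proof.
move=> jw; case: n => [//|n].
rewrite /(rot j w) -{1}(cat_take_drop j w).
set x := take j w; set y := drop j w.
have -> : j = size x by rewrite size_take_min; apply/esym/minn_idPl.
by rewrite [in LHS]/wpow /= -catA rot_size_cat -catA cat_wpow catA.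
Qed.

Lemma rot1_rot (w : word) j : exists k, rot 1 (rot j w) = rot k w.
Proof.
have [jw|wj] := ltnP j (size w); first by exists j.+1; rewrite -rotD ?add1n.
by exists 1%N; rewrite (rot_oversize wj).
Qed.

(** The offset j may exceed [size w], where k is j reduced modulo that size; rotating one letter at
    a time avoids the division. *)
Lemma rot_wpow (w : word) n j : exists k, rot j (wpow w n) = wpow (rot k w) n.
Proof.
elim: j => [|j [k IH]]; first by exists 0%N; rewrite !rot0.
have [jw|wj] := ltnP j (size (wpow w n)); last first.
  by exists 0%N; rewrite rot0 rot_oversize // ltnW.
have [l El] := rot1_rot w k.
exists l; rewrite -add1n rotD ?add1n // IH rot_wpow_le ?El // size_rot.
by case: (w) jw; rewrite // size_wpow muln0.
Qed.

Lemma mxtrace_wprod_rot (R : comPzRingType) (A B : 'M[R]_2) w j :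
  \tr (wprod A B (rot j w)) = \tr (wprod A B w).
Proof.
by rewrite /rot wprod_cat mxtrace_mulC -wprod_cat cat_take_drop.
Qed.

(** * The three-state automaton *)

(* The letters of [w] act from right to left, so [state w] is the number of
   leading [b]s of [w], capped at 2. *)
Fixpoint state (w : word) : nat :=
  if w is c :: w' then if c then minn (state w').+1 2 else 0%N else 0%N.

Lemma state_lt3 w : (state w < 3)%N.
Proof. by case: w => [//|[] w] //=; rewrite ltnS geq_minr. Qed.

(** Prepending a letter is one transition. Once strict, the inequality stays strict, because the
    matrices preserve [vlt]. Equality survives only along the tight transitions 0 -b-> 1 -b-> 2 -a->
    0, and these spell b^i (abb)^k. *)
Lemma wprod_state (F : realFieldType) (A B : 'M[F]_2) (m : F) (V : nat -> 'cV[F]_2) :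
    nonneg_SL2 A -> nonneg_SL2 B -> 0 < m ->
    A *m V 2 = m *: V 0 -> B *m V 0 = m *: V 1 -> B *m V 1 = m *: V 2 ->
    vlt (A *m V 0) (m *: V 0) -> vlt (A *m V 1) (m *: V 0) ->
    vlt (B *m V 2) (m *: V 2) ->
  forall w, vlt (wprod A B w *m V 0) (m ^+ size w *: V (state w)) \/
    wprod A B w *m V 0 = m ^+ size w *: V (state w) /\
    exists k, w = nseq (state w) true ++ wpow w_abb k.
Proof.
move=> AP BP m0 A2 B0 B1 A0 A1 B2; elim=> [|c w IH].
  by right; rewrite /wprod big_nil mul1mx scale1r; split=> //; exists 0%N.
have scale n (x y : 'cV[F]_2) :
    vlt x (m *: y) -> vlt (m ^+ n *: x) (m ^+ n.+1 *: y).
  by move=> xy; rewrite exprSr -scalerA; apply: vltZ; rewrite ?exprn_gt0.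
have step (M : 'M[F]_2) i j : nonneg_SL2 M -> vlt (M *m V i) (m *: V j) \/
    M *m V i = m *: V j -> state w = i ->
    vlt (wprod A B w *m V 0) (m ^+ size w *: V (state w)) ->
    vlt (M *m wprod A B w *m V 0) (m ^+ (size w).+1 *: V j).
  move=> MP Mij -> /(vlt_mulmx MP); rewrite mulmxA -scalemxAr => lt.
  case: Mij => [/(scale (size w))|Mij]; first exact: vlt_trans.
  by rewrite Mij scalerA -exprSr in lt.
rewrite wprod_cons /=; have := state_lt3 w.
case: c.
  case: IH => [lt|[eq [k wE]]] lt3.
    left; case E: (state w) lt3 => [|[|[|//]]] _.
    - by apply: (step B 0%N 1%N) => //; right.
    - by apply: (step B 1%N 2%N) => //; right.
    - by apply: (step B 2%N 2%N) => //; left.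
  rewrite -mulmxA eq -scalemxAr.
  case E: (state w) wE lt3 => [|[|[|//]]] wE _.
  - by right; rewrite B0 scalerA -exprSr; split=> //; exists k; rewrite wE.
  - by right; rewrite B1 scalerA -exprSr; split=> //; exists k; rewrite wE.
  - by left; apply: scale.
case: IH => [lt|[eq [k wE]]] lt3.
  left; case E: (state w) lt3 => [|[|[|//]]] _.
  - by apply: (step A 0%N 0%N) => //; left.
  - by apply: (step A 1%N 0%N) => //; left.
  - by apply: (step A 2%N 0%N) => //; right.
rewrite -mulmxA eq -scalemxAr.
case E: (state w) wE lt3 => [|[|[|//]]] wE _.
- by left; apply: scale.
- by left; apply: scale.
- by right; rewrite A2 scalerA -exprSr; split=> //; exists k.+1; rewrite wE.
Qed.

(** * Existence of m, and the three lossy transitions *)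

(** Clearing the denominator gives x^6 - t x^3 + 1, which is negative at 1 and positive at t. *)
Lemma cube_root_exists (F : rcfType) (t : F) : 2 < t ->
  exists2 m, 1 < m & m ^+ 3 + (m ^+ 3)^-1 = t.
Proof.
move=> t2; pose p : {poly F} := 'X^6 - t *: 'X^3 + 1.
have pE x : p.[x] = (x ^+ 3) ^+ 2 - t * x ^+ 3 + 1.
  by rewrite /p !hornerE -exprM.
have [||m /andP[m1 _] /eqP pm] := @poly_ivt F p 1 t.
- lra.
- rewrite !pE !expr1n.
  apply/andP; split; first lra.
  have -> : (t ^+ 3) ^+ 2 - t * t ^+ 3 + 1 = t ^+ 4 * (t ^+ 2 - 1) + 1 by ring.
  have h : 0 < t ^+ 2 - 1 by nra.
  by rewrite addr_ge0 // mulr_ge0 ?(ltW h) // exprn_ge0 //; lra.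
have {m1}m1 : 1 < m.
  rewrite lt_def m1 andbT; apply/eqP => m1'; move: pm.
  by rewrite pE m1' !expr1n; lra.
exists m => //; rewrite pE in pm.
have m0 : m ^+ 3 != 0 by rewrite expf_neq0 // gt_eqF //; lra.
by apply: (mulfI m0); rewrite mulrDr divff //; lra.
Qed.

Lemma vlt0_mulmx (F : realFieldType) (M : 'M[F]_2) (v : 'cV[F]_2) :
  nonneg_SL2 M -> vlt 0 v -> vlt 0 (M *m v).
Proof. by move=> MP /(vlt_mulmx MP); rewrite mulmx0. Qed.

(** Cayley-Hamilton ties v, Av, Bv, B^2 v, ABv and B^3 v together by relations with scalar
    coefficients. These hold in each coordinate separately, so each claim becomes an inequality
    between real numbers. Powers of m are cleared from the vectors v_i. *)
Lemma suboptimal_steps (F : realFieldType) (A B : 'M[F]_2) (m : F) (v : 'cV[F]_2)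
    (a := \tr A) (b := \tr B) :
    nonneg_SL2 A -> nonneg_SL2 B -> 0 < a -> 0 < b -> 0 < m -> vlt 0 v ->
    A *m (B *m (B *m v)) = m ^+ 3 *: v ->
    a < m -> a < m ^+ 2 * (b - m) ->
    ((b - m) * b - 1) * (a * m ^+ 3 + 1) < (b - m) * b ->
  [/\ vlt (A *m v) (m *: v), vlt (A *m (B *m v)) (m ^+ 2 *: v) &
      vlt (B *m (B *m (B *m v))) (m *: (B *m (B *m v)))].
Proof.
move=> AP BP a0 b0 m0 v0 Cv am aeta bth.
have CH (M : 'M[F]_2) (x : 'cV[F]_2) : nonneg_SL2 M ->
    M *m (M *m x) = \tr M *: (M *m x) - x.
  by move=> [_ dM]; rewrite mulmxA Cayley_Hamilton2 // mulmxBl mul1mx -scalemxAl.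
have k0 : 0 < m ^+ 3 by rewrite exprn_gt0.
have th0 : 0 < b - m.
  by rewrite -(pmulr_rgt0 _ (exprn_gt0 2 m0)); apply: lt_trans aeta.
have coord (i : 'I_2) : [/\ (A *m v) i 0 < m * v i 0,
    (A *m (B *m v)) i 0 < m ^+ 2 * v i 0 &
    (B *m (B *m (B *m v))) i 0 < m * (B *m (B *m v)) i 0].
  have at_i (x y : 'cV[F]_2) : x = y -> x i 0 = y i 0 by move->.
  have := at_i _ _ (CH _ (B *m v) BP).
  have := at_i _ _ (congr1 (mulmx A) (CH _ v BP)).
  have := at_i _ _ (CH _ v BP).
  have := at_i _ _ (CH _ (B *m (B *m v)) AP).
  have X0 := v0 i; have P0 := vlt0_mulmx AP v0 i.
  have Bv0 := vlt0_mulmx BP v0; have Y0 := Bv0 i.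
  have BBv0 := vlt0_mulmx BP Bv0; have Z0 := BBv0 i.
  have scaleE (s : F) (x : 'cV[F]_2) : (s *: x) i 0 = s * x i 0 by rewrite mxE.
  have subE (x y : 'cV[F]_2) : (x - y) i 0 = x i 0 - y i 0 by rewrite !mxE.
  rewrite mulmxBr Cv -!scalemxAr -/a -/b !(subE, scaleE).
  move: X0 P0 Y0 Z0; rewrite (mxE _ _ i 0 : (0 : 'cV[F]_2) i 0 = 0).
  move: (v i 0) ((A *m v) i 0) ((B *m v) i 0) ((B *m (B *m v)) i 0).
  move: ((A *m (B *m v)) i 0) ((B *m (B *m (B *m v))) i 0) => Q T X P Y Z.
  move=> X0 P0 Y0 Z0 eP eZ eQ eT.
  (* A v = a v - B^2 v / m^3 by Cayley-Hamilton applied to A B^2 v = m^3 v. *)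
  have PaX : P < a * X.
    by rewrite -(ltr_pM2l k0) eP mulrCA ltrBlDr ltrDl.
  split.
  - by apply: lt_trans PaX _; rewrite ltr_pM2r.
  (* Here b Q = m^3 X + P, and P < a X. *)
  - have : a * X < m ^+ 2 * (b - m) * X by rewrite ltr_pM2r.
    have -> : m ^+ 2 * (b - m) * X = b * (m ^+ 2 * X) - m ^+ 3 * X by ring.
    by move=> h; rewrite -(ltr_pM2l b0); lra.
  - have bY : b * Y < (a * m ^+ 3 + 1) * X.
      by have := mulr_gt0 k0 P0; rewrite eP; lra.
    (* Substituting T = b Z - Y and Z = b Y - X turns T < m Z into this inequality. *)
    suff : ((b - m) * b - 1) * Y < (b - m) * X.
      by rewrite eT; nra.
    have [c|c] := lerP ((b - m) * b - 1) 0.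
      by apply: le_lt_trans (mulr_gt0 th0 X0); rewrite mulr_le0_ge0 // ltW.
    rewrite -(ltr_pM2l b0) mulrCA mulrA [ltRHS]mulrA [b * (b - m)]mulrC.
    rewrite -mulrA.
    apply: lt_trans (_ : _ < ((b - m) * b - 1) * ((a * m ^+ 3 + 1) * X)) _.
      by rewrite ltr_pM2l.
    by rewrite mulrA ltr_pM2r.
split=> i; rewrite [in ltRHS]mxE; by case: (coord i).
Qed.

(** * Traces of words, and the passage from integers to reals *)

Lemma mxtrace_wpow_rot (R : comPzRingType) (A B : 'M[R]_2) w j n :
  \tr (wprod A B (wpow (rot j w) n)) = \tr (wprod A B (wpow w n)).
Proof.
have [jw|wj] := leqP j (size w); last by rewrite rot_oversize // ltnW.
by rewrite -rot_wpow_le // mxtrace_wprod_rot.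
Qed.

Lemma wprod_map (A B : 'M[int]_2) (F : pzRingType) w :
  map_mx intr (wprod A B w) = wprod (map_mx intr A) (map_mx intr B) w :> 'M[F]_2.
Proof.
elim: w => [|c w IH]; first by rewrite /wprod !big_nil map_mx1.
by rewrite !wprod_cons map_mxM IH; case: c.
Qed.

Lemma nonneg_SL2_map (F : numDomainType) (M : 'M[int]_2) :
  nonneg_SL2 M -> nonneg_SL2 (map_mx intr M : 'M[F]_2).
Proof.
move=> [M0 dM]; split=> [i j|]; first by rewrite mxE ler0z.
by rewrite det_map_mx dM.
Qed.

Lemma nonneg_SL2_trace (M : 'M[int]_2) : nonneg_SL2 M -> 2 <= \tr M.
Proof.
move=> [M0]; rewrite det2 mxtrace2.
have := mulr_ge0 (M0 ord0 ord_max) (M0 ord_max ord0).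
move: (M0 ord0 ord0) (M0 ord_max ord_max).
move: (M ord0 ord0) (M ord_max ord_max) (M _ _ * M _ _) => p u qr p0 u0 qr0 d.
have p1 : 1 <= p by nia.
have u1 : 1 <= u by nia.
lia.
Qed.

Lemma mxtrace_ABB (R : comPzRingType) (A B : 'M[R]_2) :
    \det B = 1 -> \tr (A *m B) = \tr (B *m B) ->
  \tr (A *m (B *m B)) = \tr B ^+ 3 - 2 * \tr B - \tr A.
Proof.
move=> dB trAB; have BB := Cayley_Hamilton2 dB.
have trBB : \tr (B *m B) = \tr B * \tr B - 2.
  by rewrite BB linearB linearZ /= mxtrace1.
rewrite BB mulmxBr -scalemxAr mulmx1 linearB linearZ /= trAB trBB; ring.
Qed.

(** * The comparison of an arbitrary word with abb *)

(** The exponents 3 and [size w] are those of [wle] for w against abb. The strict alternative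
    therefore both bounds w by abb and excludes w from being maximal. *)
Lemma mxtrace_word_dichotomy (A B : 'M[int]_2) :
    nonneg_SL2 A -> nonneg_SL2 B -> \tr A < \tr B ->
    \tr (A *m B) = \tr (B *m B) ->
  forall w, (exists k n, w = wpow (rot k w_abb) n) \/
    \tr (wprod A B (wpow w 3)) < \tr (wprod A B (wpow w_abb (size w))).
Proof.
move=> AP BP trAltB trAB w.
pose F : rcfType := Rdefinitions.R.
pose A' : 'M[F]_2 := map_mx intr A; pose B' : 'M[F]_2 := map_mx intr B.
have AP' : nonneg_SL2 A' by apply: nonneg_SL2_map.
have BP' : nonneg_SL2 B' by apply: nonneg_SL2_map.
pose C := A *m (B *m B).
have CP : nonneg_SL2 C by do 2![apply: nonneg_SL2_mul => //].
have a2 := nonneg_SL2_trace AP.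
have trC : \tr C = \tr B ^+ 3 - 2 * \tr B - \tr A.
  by apply: mxtrace_ABB trAB; case: BP.
have trC2 : 2 < \tr C.
  have b3 : 3 <= \tr B by lia.
  by rewrite trC; move: (\tr A) (\tr B) trAltB b3 => a b; nia.
have [q0 r0] := nonneg_SL2_offdiag CP trC2.
have [m m1 trm] : exists2 m : F, 1 < m & m ^+ 3 + (m ^+ 3)^-1 = (\tr C)%:~R.
  by apply: cube_root_exists; rewrite (ltr_int F 2).
have m0 : 0 < m by apply: lt_trans m1.
have k1 : 1 < m ^+ 3 by rewrite exprn_egt1.
pose C' : 'M[F]_2 := map_mx intr C.
have CP' : nonneg_SL2 C' by apply: nonneg_SL2_map.
have [v v0 Cv] : exists2 v : 'cV[F]_2, vlt 0 v & C' *m v = m ^+ 3 *: v.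
  apply: perron_vector => //; first by rewrite /C' mxE ltr0z.
    by rewrite /C' mxE ltr0z.
  by rewrite trm; apply: trace_map_mx.
have Cv' : A' *m (B' *m (B' *m v)) = m ^+ 3 *: v.
  by rewrite -Cv /C' /C !map_mxM -!mulmxA.
have trA' : \tr A' = (\tr A)%:~R by apply: trace_map_mx.
have trB' : \tr B' = (\tr B)%:~R by apply: trace_map_mx.
have [am aeta bth] : [/\ \tr A' < m, \tr A' < m ^+ 2 * (\tr B' - m) &
      ((\tr B' - m) * \tr B' - 1) * (\tr A' * m ^+ 3 + 1) < (\tr B' - m) * \tr B'].
  apply: cube_root_bounds => //.
  - by rewrite trA' (ler_int F 2).
  - by rewrite trA' trB' -(intrD F _ 1) ler_int lezD1.
  (* For integers, 2 <= a < b < 4 leaves only a = 2 and b = 3. *)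
  - have [b3|b3] := leP 4 (\tr B); first by right; rewrite trB' (ler_int F 4).
    have [-> ->] : \tr A' = 2%:~R /\ \tr B' = 3%:~R; last by left.
    by rewrite trA' trB'; split; congr (_%:~R); lia.
  - by rewrite trm trC trA' trB' !rmorphB rmorphXn rmorphM.
have a0 : 0 < \tr A' by rewrite trA' ltr0z; lia.
have b0 : 0 < \tr B' by rewrite trB' ltr0z; lia.
have [sA sAB sB] := suboptimal_steps AP' BP' a0 b0 m0 v0 Cv' am aeta bth.
have trABB n : \tr (wprod A' B' (wpow w_abb n)) = m ^+ (3 * n) + (m ^+ (3 * n))^-1.
  rewrite wprod_wpow.
  have -> : wprod A' B' w_abb = C'.
    by rewrite !wprod_cons /wprod big_nil mulmx1 /C' /C !map_mxM.
  apply: (@mxtrace_eigen _ _ v).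
  - elim: n => [|n IH]; first by rewrite expr0 det1.
    by rewrite exprS det_mulmx IH; case: CP' => _ ->; rewrite mulr1.
  - by apply: contraTneq (v0 ord0) => ->; rewrite ltxx.
  - by rewrite expf_neq0 // gt_eqF.
  rewrite exprM; elim: n => [|n IH]; first by rewrite !expr0 mul1mx scale1r.
  by rewrite exprSr -mulmxA Cv -scalemxAr IH scalerA -exprS.
pose V i : 'cV[F]_2 :=
  if i is i'.+1 then if i' is 0%N then m^-1 *: (B' *m v)
  else m^-1 *: (m^-1 *: (B' *m (B' *m v))) else v.
have ZC s t (x : 'cV[F]_2) : s *: (t *: x) = t *: (s *: x).
  by rewrite !scalerA mulrC.
have mV (x : 'cV[F]_2) : m *: (m^-1 *: x) = x.
  by rewrite scalerA divff ?scale1r // gt_eqF.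
(* It is enough to find a strict loss for one word u with the length and cube trace of w, from any
   positive x. Cubing the estimate gives s = m^(3|w|), and s + 1/s is the trace of (abb)^|w|. *)
have strict u x : size u = size w ->
    \tr (wprod A' B' (wpow u 3)) = \tr (wprod A' B' (wpow w 3)) ->
    vlt 0 x -> vlt (wprod A' B' u *m x) (m ^+ size u *: x) ->
  \tr (wprod A B (wpow w 3)) < \tr (wprod A B (wpow w_abb (size w))).
  move=> su tru x0 ux; rewrite -(ltr_int F) -!trace_map_mx !wprod_map.
  rewrite -tru trABB -su mulnC exprM wprod_wpow.
  have UP := wprod_nonneg_SL2 u AP' BP'.
  have s0 : 0 < m ^+ size u by rewrite exprn_gt0.
  apply: (mxtrace_lt_of_vlt _ x0); last exact: vlt_exp.
  - by rewrite -wprod_wpow; apply: wprod_nonneg_SL2.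
  - by rewrite exprn_gt0.
have i0 : 0 < m^-1 by rewrite invr_gt0.
have B2 : vlt (B' *m V 2) (m *: V 2).
  rewrite /V -!scalemxAr 2!(ZC m).
  by do 2!apply: vltZ => //.
have V2 : vlt 0 (V 2).
  rewrite -(scaler0 _ m^-1) -(scaler0 _ m^-1); do 2!apply: vltZ => //.
  by do 2!apply: vlt0_mulmx => //.
have [aw|aw] := boolP (false \in w); last first.
  (* A word without a is b^n; starting from [V 2], every b is a lossy step that stays in state 2. *)
  have {}aw : w = wpow [:: true] (size w).
    elim: w aw {strict} => [//|[] w IH] /=; rewrite ?in_cons //= => /IH {1}->.
    by [].
  have [/size0nil->|/prednK E] := posnP (size w); first by left; exists 0%N, 0%N.
  right; apply: (strict w (V 2)) => //.
  rewrite {1}aw -E wprod_wpow wprod_cons [wprod _ _ [::]]big_nil mulmx1.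
  exact: vlt_exp.
(* Rotate w to begin with a. That letter acts last, so the run ends in state 0, where it began, and
   yields an estimate of the form Mv < sv. *)
pose j := index false w.
have [w' rE] : exists w', rot j w = false :: w'.
  by exists (drop j.+1 w ++ take j w); rewrite rot_index.
have [lt|[_ [k kE]]] :
    vlt (wprod A' B' (rot j w) *m V 0) (m ^+ size (rot j w) *: V (state (rot j w))) \/
    wprod A' B' (rot j w) *m V 0 = m ^+ size (rot j w) *: V (state (rot j w)) /\
    exists k, rot j w = nseq (state (rot j w)) true ++ wpow w_abb k.
- apply: wprod_state => //.
  + by rewrite /V -!scalemxAr Cv' !scalerA; congr (_ *: _); field; rewrite gt_eqF.
  + by rewrite mV.
  + by rewrite /V mV -scalemxAr.
  + by rewrite /V -scalemxAr -[m *: v]mV ZC; apply: vltZ; rewrite // scalerA -expr2.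
- right; apply: (strict (rot j w) v) => //.
  + by rewrite size_rot.
  + exact: mxtrace_wpow_rot.
  + by move: lt; rewrite rE.
(* In state 0 there is no prefix of b's, so the rotated word is exactly (abb)^k; rotating back gives
   w. *)
left; rewrite rE /= -rE in kE.
have [l lE] := rot_wpow w_abb k (size (wpow w_abb k) - j).
exists l, k; rewrite -lE -kE; exact/esym/(rotK j).
Qed.

Lemma wtrE (A B : 'M[int]_2) w : wtr A B w = \tr (wprod A B w).
Proof. by []. Qed.

(** * Maximal words, Lyndon words and the conclusion *)

Lemma maximal_rot (A B : 'M[int]_2) :
    nonneg_SL2 A -> nonneg_SL2 B -> \tr A < \tr B ->
    \tr (A *m B) = \tr (B *m B) ->
  forall w, maximal A B w -> exists k n, w = wpow (rot k w_abb) n.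
Proof.
move=> AP BP ltAB trAB w [_ /(_ w_abb isT)]; rewrite /wle !wtrE => wmax.
have [//|] := mxtrace_word_dichotomy AP BP ltAB trAB w.
by rewrite ltNge wmax.
Qed.

Lemma maximal_abb (A B : 'M[int]_2) :
    nonneg_SL2 A -> nonneg_SL2 B -> \tr A < \tr B ->
    \tr (A *m B) = \tr (B *m B) ->
  maximal A B w_abb.
Proof.
move=> AP BP ltAB trAB; split=> // w w0; rewrite /wle !wtrE.
have [[k [n ->]]|/ltW //] := mxtrace_word_dichotomy AP BP ltAB trAB w.
rewrite wprod_wpow size_wpow size_rot wprod_wpow -exprM -wprod_wpow.
by rewrite mxtrace_wpow_rot wprod_wpow.
Qed.

Lemma lyndon_abb : lyndon w_abb.
Proof. by split=> // -[|[|[|k]]]. Qed.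

(** The word s rearranges abb, and for bab and bba the rotation by one letter is already smaller. *)
Lemma lyndon_rot_abb s k l : lyndon s -> rot k s = rot l w_abb -> s = w_abb.
Proof.
move=> [_ slex] rots.
have : perm_eq s w_abb by rewrite -(perm_rot k) rots perm_rot.
have s3 : size s = 3%N by rewrite -(size_rot k) rots size_rot.
move: slex; case: s s3 {rots} => [|x [|y [|z []]]] //= _.
by case: x y z => [] [] [] // /(_ 1%N isT); rewrite ?rot1_cons.
Qed.

Lemma lexltxx w : lexlt w w = false.
Proof. by elim: w => //= c w ->; case: c. Qed.

(** For n >= 2 the rotation by 3 is proper and fixes w, so the Lyndon condition would give w < w. *)
Lemma lyndon_wpow_abb w k n : lyndon w -> w = wpow (rot k w_abb) n -> w = w_abb.
Proof.
case: n => [|[|n]] wl wE; first by case: wl; rewrite wE.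
  by apply: (@lyndon_rot_abb w 0 k wl); rewrite rot0 wE /wpow /= cats0.
have [_ /(_ 3%N)] := wl.
have -> : rot 3 w = w.
  have su : size (rot k w_abb) = 3%N by rewrite size_rot.
  by rewrite wE rot_wpow_le ?su // rot_oversize ?su.
by rewrite lexltxx wE size_wpow size_rot => /(_ isT).
Qed.

Theorem theorem6p7 (A B : 'M[int]_2) :
  SL2Znn A -> SL2Znn B -> A * B != B * A ->
  well_oriented A B ->
  \tr A < \tr B ->
  \tr (A * B) = \tr (B * B) ->
  forall S : word -> Prop,
    complete_optimal A B S <-> (forall w, S w <-> w = w_abb).
Proof.
move=> AP BP _ _ ltAB trAB S; split=> [[Smax Sall]|SE].
  have Sabb s : S s -> s = w_abb.
    move=> /Smax [smax slyn].
    have [k [n sE]] := maximal_rot AP BP ltAB trAB smax.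
    exact: lyndon_wpow_abb slyn sE.
  (* Completeness applied to the maximal word abb shows that S is not empty. *)
  have [s [_ [_ [Ss _]]]] := Sall _ (maximal_abb AP BP ltAB trAB).
  by move=> w; split=> [/Sabb//|->]; rewrite -(Sabb s Ss).
split=> [s /SE->|w wmax].
  by split; [apply: maximal_abb | apply: lyndon_abb].
have [k [n wE]] := maximal_rot AP BP ltAB trAB wmax.
by exists w_abb, k, n; split; [apply/SE|].
Qed.
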